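(* Let $N,K\in\mathbb{N}$, $\tau\in\mathbb{N}_0$, and for $i,j\in\{1,\ldots,N\}$, $k\in\{1,\ldots,K\}$ let $c_i:\mathbb{N}_0\to(-1,1)$, $\tau_{ijk}:\mathbb{N}_0\to\mathbb{N}_0$, $b_{ijk},I_i:\mathbb{N}_0\to\mathbb{R}$ and $f_{ijk}:\mathbb{R}\to\mathbb{R}$ be functions. Assume that the functions $b_{ijk}$ and $\tau_{ijk}$ are bounded, and that for each $i,j,k$ there is a constant $F_{ijk}$ such that $|f_{ijk}(x)-f_{ijk}(y)|\le F_{ijk}|x-y|$ for all $x,y\in\mathbb{R}$. Let $c_i^+=\sup_{m}|c_i(m)|$ and $b_{ijk}^+=\sup_m|b_{ijk}(m)|$. If $$1-c_i^+>\sum_{j=1}^N\sum_{k=1}^K b_{ijk}^+F_{ijk}\qquad\text{for all }i\in\{1,\ldots,N\},$$ then the model $$x_i(m+1)=c_i(m)\,x_i(m-\tau)+\sum_{j=1}^N\sum_{k=1}^K b_{ijk}(m)f_{ijk}\big(x_j(m-\tau_{ijk}(m))\big)+I_i(m),\quad m\in\mathbb{N}_0,\ i\in\{1,\ldots,N\},$$ is globally exponentially stable.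
   Context: $\mathbb{N}=\{1,2,\ldots\}$, $\mathbb{N}_0=\mathbb{N}\cup\{0\}$. Put $r=-\max_{i,j,k,m}\{\tau_{ijk}(m),\tau\}$ (maximum over all indices and all $m\in\mathbb{N}_0$). For $I\subseteq\mathbb{R}$, $I_{\mathbb{Z}}=I\cap\mathbb{Z}$. $X$ is the space of functions $\alpha:[r,0]_{\mathbb{Z}}\to\mathbb{R}$ with norm $\|\alpha\|=\max_{j=r,\ldots,0}|\alpha(j)|$. $X^N$ carries the norm $\|\overline\alpha\|=\max_{i=1,\ldots,N}\|\alpha_i\|$. For $\overline{x}=(x_1,\ldots,x_N):[r,+\infty)_{\mathbb{Z}}\to\mathbb{R}^N$ and $m\in\mathbb{N}_0$, $\overline{x}_m\in X^N$ is defined by $\overline{x}_m(j)=\overline{x}(m+j)$, $j=r,\ldots,0$. For $\overline\alpha\in X^N$, $\overline{x}(\cdot,\overline\alpha)$ is the unique solution with $\overline{x}_0=\overline\alpha$, and $\overline{x}_m(\cdot,\overline\alpha)$ is its segment at time $m$. The model is globally exponentially stable if there are $C>0$ and $\zeta\in(0,1)$ such that $\|\overline{x}_m(\cdot,\overline\alpha)-\overline{x}_m(\cdot,\overline\beta)\|\le C\zeta^m\|\overline\alpha-\overline\beta\|$ for all $\overline\alpha,\overline\beta\in X^N$ and $m\in\mathbb{N}_0$. *)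

(* Defs.v *)
From mathcomp Require Import all_boot all_order all_algebra.
From mathcomp Require Import all_classical all_reals all_analysis.
From mathcomp Require Import zify.
Set Implicit Arguments.
Unset Strict Implicit.
Unset Printing Implicit Defensive.
Import Order.TTheory GRing.Theory Num.Theory numFieldNormedType.Exports.
Local Open Scope classical_set_scope.
Local Open Scope ring_scope.

Definition delays (N K : nat) (tau : nat)
    (tauf : 'I_N -> 'I_N -> 'I_K -> nat -> nat) : set nat :=
  [set d | d = tau \/ exists i j k m, d = tauf i j k m].

(* The nonnegative integer [-r]. The set of delays is nonempty, and when it is
   bounded its supremum in [nat] is its maximum, see [max_delayP]. *)
Definition max_delay (N K : nat) (tau : nat)
    (tauf : 'I_N -> 'I_N -> 'I_K -> nat -> nat) : nat :=
  supremum 0%N (delays tau tauf).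

(* The space X^N, where [h] stands for [-r]: [alpha i l] is the value
   alpha_i(j) at [j = l - h], so that [l = 0, .., h] corresponds to
   [j = r, .., 0]. The norm of X^N is the library norm on matrices, see
   [normXNE]. *)
Definition XN (R : realType) (N h : nat) := 'M[R]_(N, h.+1).

(* Functions on [r, +oo[ /\ Z are represented by functions on [int], whose
   values below [r] are irrelevant. *)
Definition segment (R : realType) (N h : nat)
    (x : int -> 'I_N -> R) (m : nat) : XN R N h :=
  \matrix_(i < N, l < h.+1) x (m%:Z + (l%:Z - h%:Z)) i.

Definition is_solution (R : realType) (N K : nat)
    (c : 'I_N -> nat -> R) (tau : nat)
    (tauf : 'I_N -> 'I_N -> 'I_K -> nat -> nat)
    (b : 'I_N -> 'I_N -> 'I_K -> nat -> R)
    (f : 'I_N -> 'I_N -> 'I_K -> R -> R)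
    (I : 'I_N -> nat -> R) (x : int -> 'I_N -> R) : Prop :=
  forall (m : nat) (i : 'I_N),
    x (m%:Z + 1) i =
      c i m * x (m%:Z - tau%:Z) i
      + \sum_(j < N) \sum_(k < K)
          b i j k m * f i j k (x (m%:Z - (tauf i j k m)%:Z) j)
      + I i m.

(* The solution x(., alpha). It exists by [solution_exists] and its values on
   [r, +oo[ /\ Z are uniquely determined by [solution_unique]. *)
Definition solution (R : realType) (N K : nat)
    (c : 'I_N -> nat -> R) (tau : nat)
    (tauf : 'I_N -> 'I_N -> 'I_K -> nat -> nat)
    (b : 'I_N -> 'I_N -> 'I_K -> nat -> R)
    (f : 'I_N -> 'I_N -> 'I_K -> R -> R)
    (I : 'I_N -> nat -> R)
    (alpha : XN R N (max_delay tau tauf)) : int -> 'I_N -> R :=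
  xget (fun _ _ => 0)
    [set x : int -> 'I_N -> R | is_solution c tau tauf b f I x /\
             segment (max_delay tau tauf) x 0 = alpha].

Definition globally_exponentially_stable (R : realType) (N K : nat)
    (c : 'I_N -> nat -> R) (tau : nat)
    (tauf : 'I_N -> 'I_N -> 'I_K -> nat -> nat)
    (b : 'I_N -> 'I_N -> 'I_K -> nat -> R)
    (f : 'I_N -> 'I_N -> 'I_K -> R -> R)
    (I : 'I_N -> nat -> R) : Prop :=
  let h := max_delay tau tauf in
  exists C zeta : R, 0 < C /\ 0 < zeta < 1 /\
    forall (alpha beta : XN R N h) (m : nat),
      `|segment h (solution c b f I alpha) m
        - segment h (solution c b f I beta) m|
      <= C * zeta ^+ m * `|alpha - beta|.

Lemma max_delayP (N K : nat) (tau : nat)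
    (tauf : 'I_N -> 'I_N -> 'I_K -> nat -> nat) :
  (forall i j k, exists T : nat, forall m, (tauf i j k m <= T)%N) ->
  delays tau tauf (max_delay tau tauf) /\
  (forall d, delays tau tauf d -> (d <= max_delay tau tauf)%N).
Proof.
move=> bnd.
pose T i j k := proj1_sig (cid (bnd i j k)).
have TP i j k m : (tauf i j k m <= T i j k)%N by rewrite /T; case: cid.
pose U := (tau + \sum_i \sum_j \sum_k T i j k)%N.
have UP d : delays tau tauf d -> (d <= U)%N.
  case=> [->|[i [j [k [m ->]]]]]; first exact: leq_addr.
  apply: (leq_trans (TP i j k m)); rewrite /U.
  rewrite (bigD1 i) //= (bigD1 j) //= (bigD1 k) //=; lia.
have exD : exists n, `[< delays tau tauf n >].
  by exists tau; apply/asboolP; left.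
have UD d : `[< delays tau tauf d >] -> (d <= U)%N by move/asboolP/UP.
case: (ex_maxnP exD UD) => n /asboolP nD nmax.
have nub d : delays tau tauf d -> (d <= n)%N by move=> dD; apply/nmax/asboolP.
suff -> : max_delay tau tauf = n by [].
rewrite /max_delay /supremum ifF; last first.
  by apply/negbTE/set0P; exists n.
apply: xget_subset1; last exact: is_subset1_supremums.
by split=> [d /nub|y yub]; [rewrite leEnat|exact: yub].
Qed.

Lemma normXNE (R : realType) (N h : nat) (alpha : XN R N h) :
  `|alpha| = \big[Num.max/0]_(i < N) \big[Num.max/0]_(l < h.+1) `|alpha i l|.
Proof.
rewrite [LHS]/Num.norm /= mx_normrE; apply/le_anti/andP; split.
  apply/bigmax_leP; split=> [|[i l] _ /=]; first exact: bigmax_ge_id.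
  apply: le_trans (le_bigmax _ _ i).
  exact: (le_bigmax _ (fun l : 'I_h.+1 => `|alpha i l|)).
apply/bigmax_leP; split=> [|i _]; first exact: bigmax_ge_id.
apply/bigmax_leP; split=> [|l _]; first exact: bigmax_ge_id.
exact: (le_bigmax _ (fun p : 'I_N * 'I_h.+1 => `|alpha p.1 p.2|) (i, l)).
Qed.

Lemma solution_exists (R : realType) (N K : nat)
    (c : 'I_N -> nat -> R) (tau : nat)
    (tauf : 'I_N -> 'I_N -> 'I_K -> nat -> nat)
    (b : 'I_N -> 'I_N -> 'I_K -> nat -> R)
    (f : 'I_N -> 'I_N -> 'I_K -> R -> R)
    (I : 'I_N -> nat -> R)
    (alpha : XN R N (max_delay tau tauf)) :
  is_solution c tau tauf b f I (solution c b f I alpha) /\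
  segment (max_delay tau tauf) (solution c b f I alpha) 0 = alpha.
Proof.
suff ex : exists x : int -> 'I_N -> R, is_solution c tau tauf b f I x /\
   segment (max_delay tau tauf) x 0 = alpha.
  exact: (xgetPex (fun _ _ => 0) ex).
set h := max_delay tau tauf.
pose hist := fix hist (n : nat) (t : int) (i : 'I_N) : R :=
  if n is m.+1 then
    if t == m.+1%:Z then
      c i m * hist m (m%:Z - tau%:Z) i
      + \sum_(j < N) \sum_(k < K)
          b i j k m * f i j k (hist m (m%:Z - (tauf i j k m)%:Z) j)
      + I i m
    else hist m t i
  else alpha i (inord (absz (t + h%:Z))).
have histE n k t i : (t <= n%:Z)%R -> hist (n + k)%N t i = hist n t i.
  move=> tn; elim: k => [|k IH]; first by rewrite addn0.
  rewrite addnS /= IH; case: eqP => // ?; lia.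
pose x (t : int) i := if t is Posz n then hist n t i else hist 0%N t i.
have xE n t i : (t <= n%:Z)%R -> x t i = hist n t i.
  case: t => [p|p] pn; last by rewrite -[n]add0n histE.
  have -> : n = (p + (n - p))%N by lia.
  by rewrite histE.
exists x; split.
  move=> m i; rewrite (xE m.+1); last by lia.
  rewrite /= ifT; last by apply/eqP; lia.
  rewrite -/hist (xE m) ?lerBlDr; last by lia.
  congr (_ + _ + _); apply: eq_bigr => j _; apply: eq_bigr => k _.
  by rewrite (xE m) //; lia.
apply/matrixP => i l; rewrite mxE (xE 0%N); last by have := ltn_ord l; lia.
rewrite /=; congr (alpha i _); apply/val_inj.
by rewrite /= add0r subrK absz_nat inord_val.
Qed.

Lemma solution_unique (R : realType) (N K : nat)
    (c : 'I_N -> nat -> R) (tau : nat)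
    (tauf : 'I_N -> 'I_N -> 'I_K -> nat -> nat)
    (b : 'I_N -> 'I_N -> 'I_K -> nat -> R)
    (f : 'I_N -> 'I_N -> 'I_K -> R -> R)
    (I : 'I_N -> nat -> R) (x y : int -> 'I_N -> R) :
  (forall i j k, exists T : nat, forall m, (tauf i j k m <= T)%N) ->
  is_solution c tau tauf b f I x -> is_solution c tau tauf b f I y ->
  segment (max_delay tau tauf) x 0 = segment (max_delay tau tauf) y 0 ->
  forall (t : int) (i : 'I_N), - (max_delay tau tauf)%:Z <= t -> x t i = y t i.
Proof.
move=> /(max_delayP tau)[_ hub] solx soly xy0.
set h := max_delay tau tauf in hub xy0 *.
suff H n : forall (t : int) i, - h%:Z <= t <= n%:Z -> x t i = y t i.
  by move=> t i ht; apply: (H (absz t)); lia.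
elim: n => [|n IH] t i /andP[ht tn].
  have lt_h : (absz (t + h%:Z)%R < h.+1)%N by lia.
  have /matrixP/(_ i (Ordinal lt_h)) := xy0; rewrite !mxE /=.
  by have -> : 0%:Z + ((absz (t + h%:Z))%:Z - h%:Z) = t by lia.
have [tn'|] := boolP (t <= n%:Z); first by apply: IH; rewrite ht.
move=> tn'; have -> : t = n%:Z + 1 by lia.
have tauh : (tau <= h)%N by apply: hub; left.
rewrite solx soly IH; last by lia.
congr (_ + _ + _); apply: eq_bigr => j _; apply: eq_bigr => k _.
have tkh : (tauf i j k n <= h)%N by apply: hub; right; exists i, j, k, n.
by rewrite IH //; lia.
Qed.

(* Main.v *)
Require Import Defs.
From mathcomp Require Import all_boot all_order all_algebra.
From mathcomp Require Import all_classical all_reals all_analysis.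
From mathcomp Require Import zify ring lra.
Import Order.TTheory GRing.Theory Num.Theory numFieldNormedType.Exports.
Local Open Scope classical_set_scope.
Local Open Scope ring_scope.

(** The difference of two solutions satisfies a linear delay inequality. As the
    functions f_ijk are Lipschitz, the value of the difference at time m + 1 is
    at most mu times its maximum over the window [m - h, m], where h is the
    maximal delay and mu is any common upper bound of the finitely many numbers
    c_i^+ + sum_(j, k) b_ijk^+ F_ijk; this rests on [solution_contraction]. As
    these numbers are all less than 1, mu can be chosen in ]0, 1[.

    Such a window inequality forces exponential decay (a discrete Halanay
    inequality, [window_contraction_decay]): if mu <= zeta^(h + 1), then the
    bound zeta^t propagates in time, because its worst value over the window
    [m - h, m] is zeta^(m - h), and mu * zeta^(m - h) <= zeta^(m + 1). A rate
    zeta < 1 with mu <= zeta^(h + 1) exists by Bernoulli's inequality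
    ([exists_decay_rate]). A segment reaches back by h steps, so the constant C
    is zeta^(-h). *)

Lemma le_sup_range_norm (R : realType) (u : nat -> R) (B : R) (m : nat) :
  (forall n, `|u n| <= B) -> `|u m| <= sup (range (fun n => `|u n|)).
Proof.
move=> uB; apply: ub_le_sup; last by exists m.
by exists B => _ [n _ <-].
Qed.

Lemma lipschitz_const_ge0 (R : realType) (g : R -> R) (L : R) :
  (forall x y, `|g x - g y| <= L * `|x - y|) -> 0 <= L.
Proof.
by move=> /(_ 1 0); rewrite subr0 normr1 mulr1; apply: le_trans.
Qed.

(** Starting from 1/2 makes the uniform bound positive, which the decay rate
    needs even when all the [a i] vanish. *)
Lemma exists_uniform_lt1 (R : realType) (N : nat) (a : 'I_N -> R) :
  (forall i, a i < 1) ->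
  exists mu : R, 0 < mu < 1 /\ forall i, a i <= mu.
Proof.
move=> a1; exists (\big[Num.max/2^-1]_(i < N) a i); split; last first.
  by move=> i; apply: le_bigmax.
apply/andP; split.
  by apply: lt_le_trans (bigmax_ge_id _ _ _ _); rewrite invr_gt0.
by apply/bigmax_ltP; split=> // ; lra.
Qed.

Lemma bernoulli (R : realType) (u : R) (n : nat) :
  0 <= u <= 1 -> 1 - n%:R * u <= (1 - u) ^+ n.
Proof.
move=> /andP[u0 u1]; elim: n => [|n IH]; first by rewrite mul0r subr0 expr0.
rewrite exprS; apply: (@le_trans _ _ ((1 - u) * (1 - n%:R * u))).
  have : 0 <= n%:R * u * u by rewrite !mulr_ge0.
  by rewrite -natr1; lra.
by rewrite ler_wpM2l // subr_ge0.
Qed.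

(** The witness 1 - (1 - mu) / n.+1 is chosen so that the lower bound in
    Bernoulli's inequality is exactly mu; this avoids taking a root of mu. *)
Lemma exists_decay_rate (R : realType) (mu : R) (n : nat) :
  0 < mu < 1 -> exists zeta : R, 0 < zeta < 1 /\ mu <= zeta ^+ n.+1.
Proof.
move=> /andP[mu0 mu1].
pose u := (1 - mu) / n.+1%:R.
have nu : n.+1%:R * u = 1 - mu by rewrite mulrC divfK // pnatr_eq0.
have u0 : 0 < u by rewrite divr_gt0 // subr_gt0.
have u1 : u <= 1 - mu by rewrite -nu ler_peMl ?ler1n // ltW.
exists (1 - u); split; first by apply/andP; split; lra.
apply: le_trans (bernoulli _ _ n.+1 _); first by rewrite nu; lra.
by apply/andP; split; lra.
Qed.

(** A discrete Halanay inequality. The index n stands for the time n - h, so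
    that the initial window is n = 0, .., h, and the factor zeta^(-h) makes the
    bound at least D on all of that window. *)
Lemma window_contraction_decay (R : realType) (T : Type) (h : nat)
    (w : nat -> T -> R) (mu zeta D : R) :
  0 < zeta < 1 -> mu <= zeta ^+ h.+1 -> 0 <= D ->
  (forall n i, (n <= h)%N -> w n i <= D) ->
  (forall m i (M : R), (forall n j, (m <= n <= m + h)%N -> w n j <= M) ->
     w (m + h).+1 i <= mu * M) ->
  forall n i, w n i <= zeta ^- h * zeta ^+ n * D.
Proof.
move=> /andP[z0 z1] muz D0 init step.
have zle p q : (p <= q)%N -> zeta ^+ q <= zeta ^+ p.
  by move=> pq; rewrite ler_wiXn2l // ltW.
have zV0 : 0 <= zeta ^- h by rewrite invr_ge0 exprn_ge0 // ltW.
elim/ltn_ind=> n IH i.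
have [nh|hn] := leqP n h.
  apply: le_trans (init n i nh) _; rewrite ler_peMl //.
  by rewrite mulrC ler_pdivlMr ?exprn_gt0 // mul1r zle.
have [m nE] : exists m, n = (m + h).+1 by exists (n - h.+1)%N; lia.
rewrite {}nE in IH hn *.
apply: (@le_trans _ _ (mu * (zeta ^- h * zeta ^+ m * D))).
  apply: step => p j /andP[mp pmh]; apply: le_trans (IH p _ j) _ => //.
  by rewrite ler_wpM2r // ler_wpM2l // zle.
have -> : zeta ^- h * zeta ^+ (m + h).+1 * D =
          zeta ^+ h.+1 * (zeta ^- h * zeta ^+ m * D).
  by rewrite -addnS exprD; ring.
by rewrite ler_wpM2r // !mulr_ge0 // exprn_ge0 // ltW.
Qed.

(** The external inputs [I] cancel in the difference, and each delayed argument
    falls in the window over which [M] bounds the difference. *)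
Lemma solution_contraction (R : realType) (N K : nat)
    (c : 'I_N -> nat -> R) (tau : nat)
    (tauf : 'I_N -> 'I_N -> 'I_K -> nat -> nat)
    (b : 'I_N -> 'I_N -> 'I_K -> nat -> R)
    (f : 'I_N -> 'I_N -> 'I_K -> R -> R)
    (I : 'I_N -> nat -> R) (F : 'I_N -> 'I_N -> 'I_K -> R)
    (cp : 'I_N -> R) (bp : 'I_N -> 'I_N -> 'I_K -> R)
    (x y : int -> 'I_N -> R) (h m : nat) (M : R) (i : 'I_N) :
  (forall i j k (u v : R),
     `|f i j k u - f i j k v| <= F i j k * `|u - v|) ->
  `|c i m| <= cp i -> (forall j k, `|b i j k m| <= bp i j k) ->
  (tau <= h)%N -> (forall j k, (tauf i j k m <= h)%N) ->
  is_solution c tau tauf b f I x -> is_solution c tau tauf b f I y ->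
  (forall d j, (d <= h)%N -> `|x (m%:Z - d%:Z) j - y (m%:Z - d%:Z) j| <= M) ->
  `|x (m%:Z + 1) i - y (m%:Z + 1) i|
    <= (cp i + \sum_(j < N) \sum_(k < K) bp i j k * F i j k) * M.
Proof.
move=> lipf cle ble tauh taufh solx soly xyM.
rewrite solx soly.
set S := \sum_(j < N) _; set S' := \sum_(j < N) _; set S'' := \sum_(j < N) _.
have -> : c i m * x (m%:Z - tau%:Z) i + S + I i m
          - (c i m * y (m%:Z - tau%:Z) i + S' + I i m)
        = c i m * (x (m%:Z - tau%:Z) i - y (m%:Z - tau%:Z) i) + (S - S').
  by ring.
apply: le_trans (ler_normD _ _) _; rewrite mulrDl lerD //.
  by rewrite normrM ler_pM // xyM.
rewrite /S /S' /S'' -sumrB mulr_suml.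
apply: le_trans (ler_norm_sum _ _ _) _; apply: ler_sum => j _.
rewrite -sumrB mulr_suml.
apply: le_trans (ler_norm_sum _ _ _) _; apply: ler_sum => k _.
rewrite -mulrBr normrM -mulrA ler_pM //.
apply: le_trans (lipf _ _ _ _ _) _.
by rewrite ler_wpM2l ?xyM //; apply: (lipschitz_const_ge0 _ _ _ (lipf i j k)).
Qed.

Lemma le_mx_norm_entry (R : realType) (N h : nat) (A : XN R N h) i l :
  `|A i l| <= `|A|.
Proof.
rewrite normXNE; apply: le_trans (le_bigmax _ _ i).
exact: (le_bigmax _ (fun l : 'I_h.+1 => `|A i l|)).
Qed.

Lemma mx_norm_le (R : realType) (N h : nat) (A : XN R N h) (B : R) :
  0 <= B -> (forall i l, `|A i l| <= B) -> `|A| <= B.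
Proof.
move=> B0 AB; rewrite normXNE; apply/bigmax_leP; split=> // i _.
by apply/bigmax_leP; split.
Qed.

Theorem theorem5 (R : realType) (N K : nat) (hN : (0 < N)%N) (hK : (0 < K)%N)
    (tau : nat)
    (c : 'I_N -> nat -> R)
    (tauf : 'I_N -> 'I_N -> 'I_K -> nat -> nat)
    (b : 'I_N -> 'I_N -> 'I_K -> nat -> R)
    (I : 'I_N -> nat -> R)
    (f : 'I_N -> 'I_N -> 'I_K -> R -> R)
    (F : 'I_N -> 'I_N -> 'I_K -> R)
    (hc : forall i m, -1 < c i m < 1)
    (hb : forall i j k, exists B : R, forall m, `|b i j k m| <= B)
    (htau : forall i j k, exists T : nat, forall m, (tauf i j k m <= T)%N)
    (hf : forall i j k (x y : R),
        `|f i j k x - f i j k y| <= F i j k * `|x - y|)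
    (hmain : forall i,
        1 - sup (range (fun m => `|c i m|)) >
        \sum_(j < N) \sum_(k < K)
           sup (range (fun m => `|b i j k m|)) * F i j k) :
  globally_exponentially_stable c tau tauf b f I.
Proof.
pose cp i := sup (range (fun m => `|c i m|)).
pose bp i j k := sup (range (fun m => `|b i j k m|)).
have cle i m : `|c i m| <= cp i.
  apply: (@le_sup_range_norm _ _ 1) => n.
  by rewrite ltW // ltr_norml.
have ble i j k m : `|b i j k m| <= bp i j k.
  by have [B bB] := hb i j k; apply: (le_sup_range_norm _ _ _ _ bB).
have [mu [mu01 amu]] : exists mu : R, 0 < mu < 1 /\
    forall i, cp i + \sum_(j < N) \sum_(k < K) bp i j k * F i j k <= mu.
  by apply: exists_uniform_lt1 => i; rewrite addrC -ltrBrDr; apply: hmain.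
have [_ hub] := max_delayP tau htau.
rewrite /globally_exponentially_stable /=; set h := max_delay tau tauf in hub *.
have [zeta [z01 muz]] := exists_decay_rate _ _ h mu01.
have z0 : 0 < zeta by case/andP: z01.
exists (zeta ^- h), zeta; split; first by rewrite invr_gt0 exprn_gt0.
split=> // alpha beta m.
have [solx x0] := solution_exists c b f I alpha.
have [soly y0] := solution_exists c b f I beta.
set x := solution c b f I alpha in solx x0 *.
set y := solution c b f I beta in soly y0 *.
pose w n i := `|x (n%:Z - h%:Z) i - y (n%:Z - h%:Z) i|.
have decay n i : w n i <= zeta ^- h * zeta ^+ n * `|alpha - beta|.
  apply: (@window_contraction_decay _ _ h w mu) => // {n i}.
    move=> n i nh; apply: le_trans (le_mx_norm_entry _ _ _ (alpha - beta) i (inord n)).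
    by rewrite -x0 -y0 !mxE /= inordK ?ltnS // !add0r.
  move=> m0 i M wM.
  have tE : (m0 + h).+1%:Z - h%:Z = m0%:Z + 1 by lia.
  have xyM d j : (d <= h)%N ->
      `|x (m0%:Z - d%:Z) j - y (m0%:Z - d%:Z) j| <= M.
    move=> dh; have -> : m0%:Z - d%:Z = (m0 + h - d)%N%:Z - h%:Z by lia.
    by apply: wM; lia.
  have M0 : 0 <= M by apply: le_trans (xyM 0%N i _).
  rewrite /w tE.
  apply: le_trans (ler_wpM2r M0 (amu i)).
  apply: (solution_contraction _ _ _ c tau tauf b f I F cp bp x y h) => //;
    first by apply: hub; left.
  by move=> j k; apply: hub; right; exists i, j, k, m0.
apply: mx_norm_le => [|i l].
  by rewrite !mulr_ge0 // ?invr_ge0 exprn_ge0 // ltW.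
have -> : `|(segment h x m - segment h y m) i l| = w (m + l)%N i.
  by rewrite !mxE /w PoszD addrA.
apply: le_trans (decay _ _) _.
rewrite ler_wpM2r // ler_wpM2l ?invr_ge0 ?exprn_ge0 ?(ltW z0) //.
by case/andP: z01 => _ /ltW z1; rewrite ler_wiXn2l ?leq_addr ?(ltW z0).
Qed.
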